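(* Let $(X,d)$ and $(Y,d')$ be compact metric spaces and let $\varphi:\mathrm{Lip}(X,I)\longrightarrow \mathrm{Lip}(Y,I)$ be a lattice isomorphism. Then there exist a homeomorphism $\mu:Y\longrightarrow X$ and a family $\{m_y\}_{y\in Y}$ of continuous increasing bijections $m_y:I\longrightarrow I$ such that $\varphi(f)(y)=m_y(f(\mu(y)))$ for all $f\in \mathrm{Lip}(X,I)$ and $y\in Y$.
   Context: $I=[0,1]$. For a compact metric space $(X,d)$, $\mathrm{Lip}(X,I)$ is the set of all Lipschitz functions $f:X\to I$ (i.e. $|f(x)-f(x')|\le L\,d(x,x')$ for all $x,x'\in X$, for some constant $L\geq 0$ depending on $f$); it is a lattice under the pointwise operations $f\vee g=\max(f,g)$, $f\wedge g=\min(f,g)$. A lattice isomorphism is a bijection $\varphi$ with $\varphi(f\wedge g)=\varphi(f)\wedge\varphi(g)$ and $\varphi(f\vee g)=\varphi(f)\vee\varphi(g)$ for all $f,g$. *)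

(* Defs.v *)
From HB Require Import structures.
From mathcomp Require Import all_boot all_order all_algebra.
From mathcomp Require Import all_classical all_reals all_analysis.
From mathcomp Require Import lra.

Set Implicit Arguments.
Unset Strict Implicit.
Unset Printing Implicit Defensive.

Import Order.TTheory GRing.Theory Num.Theory.
Import numFieldNormedType.Exports.
Local Open Scope classical_set_scope.
Local Open Scope ring_scope.

(* The library's [k.-lipschitz f] only applies to normed modules. *)
Definition is_lipschitz (R : realType) (X : metricType R) (f : X -> R) : Prop :=
  exists2 L : R, 0 <= L & forall x x' : X, `|f x - f x'| <= L * mdist x x'.

Definition lip_pred (R : realType) (X : metricType R) : {pred X -> R} :=
  fun f => `[< (forall x : X, f x \in `[0, 1]) /\ is_lipschitz f >].
Arguments lip_pred {R} X.

Record Lip (R : realType) (X : metricType R) := MkLip {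
  lip_fun :> X -> R;
  lip_funP : lip_fun \in lip_pred X }.

Section LipLattice.
Context (R : realType) (X : metricType R).

Lemma meet_lipE (f g : X -> R) (x : X) : (f `&` g)%O x = Num.min (f x) (g x).
Proof. by rewrite [LHS]meetEtotal. Qed.

Lemma join_lipE (f g : X -> R) (x : X) : (f `|` g)%O x = Num.max (f x) (g x).
Proof. by rewrite [LHS]joinEtotal. Qed.

Lemma ler_dist_min (a b c e : R) (K : R) :
  `|a - b| <= K -> `|c - e| <= K -> `|Num.min a c - Num.min b e| <= K.
Proof.
rewrite !ler_norml => /andP[? ?] /andP[? ?].
by case: (leP a c) => ?; case: (leP b e) => ?; apply/andP; split; lra.
Qed.

Lemma ler_dist_max (a b c e : R) (K : R) :
  `|a - b| <= K -> `|c - e| <= K -> `|Num.max a c - Num.max b e| <= K.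
Proof.
rewrite !ler_norml => /andP[? ?] /andP[? ?].
by case: (leP a c) => ?; case: (leP b e) => ?; apply/andP; split; lra.
Qed.

Lemma lip_opredI : {in lip_pred X &, forall f g, (f `&` g)%O \in lip_pred X}.
Proof.
move=> f g /asboolP[f01 [L L0 fL]] /asboolP[g01 [M M0 gM]].
apply/asboolP; split=> [x|].
  by rewrite meet_lipE /Order.min; case: ifP.
exists (Num.max L M) => [|x x']; first by rewrite le_max L0.
rewrite !meet_lipE; apply: ler_dist_min.
- by rewrite (le_trans (fL _ _))// ler_wpM2r ?mdist_ge0// le_max lexx.
- by rewrite (le_trans (gM _ _))// ler_wpM2r ?mdist_ge0// le_max lexx orbT.
Qed.

Lemma lip_opredU : {in lip_pred X &, forall f g, (f `|` g)%O \in lip_pred X}.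
Proof.
move=> f g /asboolP[f01 [L L0 fL]] /asboolP[g01 [M M0 gM]].
apply/asboolP; split=> [x|].
  by rewrite join_lipE /Order.max; case: ifP.
exists (Num.max L M) => [|x x']; first by rewrite le_max L0.
rewrite !join_lipE; apply: ler_dist_max.
- by rewrite (le_trans (fL _ _))// ler_wpM2r ?mdist_ge0// le_max lexx.
- by rewrite (le_trans (gM _ _))// ler_wpM2r ?mdist_ge0// le_max lexx orbT.
Qed.

HB.instance Definition _ :=
  Order.isLatticeClosed.Build _ _ (lip_pred X) lip_opredI lip_opredU.
HB.instance Definition _ := [isSub for @lip_fun R X].
HB.instance Definition _ := [Choice of Lip X by <:].
(* [Lip X] is a sublattice of [X -> R], whose operations are pointwise. *)
HB.instance Definition _ :=
  [SubChoice_isSubLattice of Lip X by <: with FunOrder.fun_display].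

Lemma Lip_meetE (f g : Lip X) (x : X) : (f `&` g)%O x = Num.min (f x) (g x).
Proof. by rewrite -meet_lipE. Qed.

Lemma Lip_joinE (f g : Lip X) (x : X) : (f `|` g)%O x = Num.max (f x) (g x).
Proof. by rewrite -join_lipE. Qed.

End LipLattice.

Definition lattice_isomorphism (d d' : Order.disp_t)
    (T : latticeType d) (T' : latticeType d') (phi : T -> T') : Prop :=
  [/\ bijective phi,
      {morph phi : f g / (f `&` g)%O} &
      {morph phi : f g / (f `|` g)%O}].

Definition homeomorphism (S T : topologicalType) (mu : S -> T) : Prop :=
  continuous mu /\
  exists nu : T -> S, [/\ continuous nu, cancel mu nu & cancel nu mu].

(* An increasing homeomorphism of [0, 1], represented by a function on all of R
   whose values outside [0, 1] are irrelevant. *)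
Definition continuous_increasing_bijection01 (R : realType) (m : R -> R) : Prop :=
  [/\ {within `[0, 1], continuous m},
      {in `[0, 1] &, {homo m : s t / s < t}} &
      set_bij `[0, 1] `[0, 1] m].

(* Main.v *)
Require Import Defs.
From HB Require Import structures.
From mathcomp Require Import all_boot all_order all_algebra.
From mathcomp Require Import all_classical all_reals all_analysis.
From mathcomp Require Import ring lra.

Set Implicit Arguments.
Unset Strict Implicit.
Unset Printing Implicit Defensive.

Import Order.TTheory GRing.Theory Num.Theory.
Import numFieldNormedType.Exports.
Local Open Scope classical_set_scope.
Local Open Scope ring_scope.

(** Say that a point [x] of [X] supports a point [y] of [Y] when [T h y = 0] for
every [h] vanishing near [x], where [T] is the given isomorphism.

Since [T] preserves minima and the constants 0 and 1, the open sets [{h > 0}]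
with [T h y > 0] generate a proper filter, and any of its cluster points supports
[y]; compactness of [X] provides one ([supports_exists]).  If [x] supports [y],
then [T h y = 1] whenever [h = 1] near [x] ([supports_eq1]), so cutting [f] down
by a bump function at [x] shows that [f <= g] near [x] forces [T f y <= T g y]
([supports_local]).  Bump functions also show that the support point of [y] is
unique, that it depends continuously on [y], and that [y] in turn supports [x]
with respect to the inverse of [T] ([supports_sym]).  Hence [y |-> x] is a
homeomorphism [mu].

The heart of the proof is to pass from germs to values: [f x <= g x] already
implies [T f y <= T g y] ([supports_le]).  When [x] is isolated, the comparison at
[x] is a comparison near [x].  Otherwise some Lipschitz [h] oscillates fast enough
on the way to [x] to satisfy [f <= h] near some points arbitrarily close to [x]
and [h <= g] near others ([zigzag]).  Carried to [Y] by the homeomorphism, this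
says that [T f <= T h] at points arbitrarily close to [y], and [T h <= T g] at
others; as these functions are continuous, [T f y <= T h y <= T g y].

So [T f y] depends on the number [f x] only, and equals [m_y (f x)] where [m_y t]
is the value at [y] of the image of the constant [t].  Doing the same with the
inverse of [T] gives a two-sided inverse of [m_y]; a monotone bijection of [0, 1]
is strictly increasing and continuous. *)

(** * Lipschitz functions with values in the unit interval *)

Section LipschitzFunctions.
Context (R : realType) (X : metricType R).
Implicit Types (f g : X -> R) (x z : X).

Lemma lipschitz_cst (c : R) : is_lipschitz (fun _ : X => c).
Proof. by exists 0 => // x z; rewrite subrr normr0 mul0r. Qed.

Lemma lipschitz_mdist x : is_lipschitz (mdist x).
Proof.
exists 1 => // z z'; rewrite mul1r ler_norml.
have := metric_triangle x z z'; have := metric_triangle x z' z.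
by rewrite (metric_sym z'); lra.
Qed.

Lemma lipschitz_add f g :
  is_lipschitz f -> is_lipschitz g -> is_lipschitz (fun z => f z + g z).
Proof.
move=> [K K0 fK] [L L0 gL]; exists (K + L) => [|x z]; first exact: addr_ge0.
rewrite opprD addrACA mulrDl (le_trans (ler_normD _ _))//.
exact: lerD (fK _ _) (gL _ _).
Qed.

Lemma lipschitz_scale (c : R) f :
  is_lipschitz f -> is_lipschitz (fun z => c * f z).
Proof.
move=> [K K0 fK]; exists (`|c| * K) => [|x z]; first exact: mulr_ge0.
by rewrite -mulrBr normrM -mulrA ler_wpM2l.
Qed.

Lemma lipschitz_continuous f : is_lipschitz f -> continuous f.
Proof.
move=> [K K0 fK] x; apply/cvgrPdist_lt => e e0.
apply/metricType_numDomainType.nbhs_mdistP; exists (e / (K + 1)) => /=.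
  by rewrite divr_gt0// ltr_wpDl.
move=> z /=; rewrite ltr_pdivlMr ?ltr_wpDl// => xz.
apply: le_lt_trans (fK _ _) _; have := mdist_ge0 x z; lra.
Qed.

Lemma lipschitz_lt_near f g x : is_lipschitz f -> is_lipschitz g ->
  f x < g x -> \forall z \near x, f z < g z.
Proof.
move=> fL gL fgx.
have/lipschitz_continuous/(_ x)/cvgrPdist_lt/(_ (g x - f x)) :=
  lipschitz_add gL (lipschitz_scale (-1) fL).
rewrite subr_gt0 => /(_ fgx); apply: filterS => z /=.
by rewrite ltr_norml => /andP[_]; lra.
Qed.

(** The distance to [E]; on the empty set [inf] takes a default value, so the
bounds that need a point of [E] ask for one. *)
Definition setdist (E : set X) z : R := inf [set mdist z w | w in E].

Lemma setdist_le (E : set X) z w : E w -> setdist E z <= mdist z w.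
Proof.
move=> Ew; apply: ge_inf; last by exists w.
by exists 0 => _ [v _ <-]; exact: mdist_ge0.
Qed.

Lemma le_setdist (E : set X) z (r : R) : E !=set0 ->
  (forall w, E w -> r <= mdist z w) -> r <= setdist E z.
Proof.
move=> [w Ew] rE; apply: lb_le_inf; first by exists (mdist z w), w.
by move=> _ [v Ev <-]; exact: rE.
Qed.

Lemma lipschitz_setdist (E : set X) : E !=set0 -> is_lipschitz (setdist E).
Proof.
move=> E0; exists 1 => // z z'; rewrite mul1r.
have dE u v : setdist E u - mdist u v <= setdist E v.
  apply: le_setdist => // w Ew.
  by have := setdist_le u Ew; have := metric_triangle u v w; lra.
have := dE z z'; have := dE z' z.
by rewrite (metric_sym z') ler_norml; lra.
Qed.

Definition clip01 (t : R) : R := Num.max 0 (Num.min 1 t).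

Lemma clip01_itv (t : R) : clip01 t \in `[0, 1].
Proof.
by rewrite in_itv /= /clip01 le_max lexx /= ge_max ler01 ge_min lexx.
Qed.

Lemma clip01_id (t : R) : t \in `[0, 1] -> clip01 t = t.
Proof.
by rewrite in_itv /= => /andP[t0 t1]; rewrite /clip01 min_r// max_r.
Qed.

Lemma clip01_le0 (t : R) : t <= 0 -> clip01 t = 0.
Proof. by move=> t0; rewrite /clip01 max_l// ge_min t0 orbT. Qed.

Lemma clip01_ge1 (t : R) : 1 <= t -> clip01 t = 1.
Proof. by move=> t1; rewrite /clip01 min_l// max_r. Qed.

Lemma clip01_le (s t : R) : 0 <= t -> s <= t -> clip01 s <= t.
Proof. by move=> t0 st; rewrite /clip01 ge_max t0 ge_min st orbT. Qed.

Lemma le_clip01 (s t : R) : s <= 1 -> s <= t -> s <= clip01 t.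
Proof. by move=> s1 st; rewrite /clip01 le_max le_min s1 st orbT. Qed.

Lemma clip01_lipP f : is_lipschitz f -> (fun z => clip01 (f z)) \in lip_pred X.
Proof.
move=> [K K0 fK]; apply/asboolP; split=> [x|]; first exact: clip01_itv.
exists K => // x z; rewrite /clip01; apply: ler_dist_max.
  by rewrite subrr normr0 mulr_ge0 ?mdist_ge0.
apply: ler_dist_min => //.
by rewrite subrr normr0 mulr_ge0 ?mdist_ge0.
Qed.

(** Formulas for elements of [Lip X] are truncated to [0, 1], so that none of them
has to track its bounds. *)
Definition clip_lip f (fL : is_lipschitz f) : Lip X := MkLip (clip01_lipP fL).

Definition cst_lip (c : R) : Lip X := clip_lip (lipschitz_cst c).

Lemma lip_itv (f : Lip X) x : f x \in `[0, 1].
Proof. by case: f => f /= /asboolP[]. Qed.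

Lemma lip_ge0 (f : Lip X) x : 0 <= f x.
Proof. by have := lip_itv f x; rewrite in_itv /= => /andP[]. Qed.

Lemma lip_le1 (f : Lip X) x : f x <= 1.
Proof. by have := lip_itv f x; rewrite in_itv /= => /andP[]. Qed.

Lemma lip_lipschitz (f : Lip X) : is_lipschitz f.
Proof. by case: f => f /= /asboolP[]. Qed.

Lemma cst_lipE (c : R) x : c \in `[0, 1] -> cst_lip c x = c.
Proof. by move=> c01; rewrite /cst_lip /= clip01_id. Qed.

Lemma cst_lip0 x : cst_lip 0 x = 0. Proof. by rewrite /= clip01_le0. Qed.

Lemma cst_lip1 x : cst_lip 1 x = 1. Proof. by rewrite /= clip01_ge1. Qed.

Lemma lip_ext (f g : Lip X) : f =1 g -> f = g.
Proof. by move=> fg; apply/val_inj/funext. Qed.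

(** The bump is the truncation of [2 - 2 d(x, z) / e]: it equals 1 up to distance
[e / 2] from [x] and 0 from distance [e] on. *)
Lemma lip_bump x (U : set X) : nbhs x U -> exists h : Lip X,
  (\forall z \near x, h z = 1) /\ forall z, ~ U z -> h z = 0.
Proof.
move=> /metricType_numDomainType.nbhs_mdistP[e /= e0 eU].
have hL := lipschitz_add (lipschitz_cst 2)
  (lipschitz_scale (- (2 / e)) (lipschitz_mdist x)).
exists (clip_lip hL); split=> [|z Uz] /=.
  apply/metricType_numDomainType.nbhs_mdistP; exists (e / 2).
    by rewrite /= divr_gt0.
  move=> z /= xz; apply: clip01_ge1.
  have -> : 2 + - (2 / e) * mdist x z = 2 - mdist x z / (e / 2) by field; lra.
  have : mdist x z / (e / 2) < 1 by rewrite ltr_pdivrMr ?divr_gt0// mul1r.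
  lra.
apply: clip01_le0.
have xz : e <= mdist x z by rewrite leNgt; apply/negP => /eU.
have : 1 <= mdist x z / e by rewrite ler_pdivlMr ?mul1r.
have -> : 2 + - (2 / e) * mdist x z = 2 - 2 * (mdist x z / e) by field; lra.
lra.
Qed.

End LipschitzFunctions.

(** * An oscillating Lipschitz function at a non-isolated point *)

Section Zigzag.
Context (R : realType) (X : metricType R).

(** Pick points [u n] tending to [x] whose distances [r n] to [x] drop by a factor
at least 4 each time, and take for [E] those of even index.  Points of odd index
are then far from [E] compared with their distance to [x], because the triangle
inequality gives [d(u m, u n) >= |r m - r n|]. *)
Lemma lacunary_set (x : X) :
    (forall e : R, 0 < e -> exists z, 0 < mdist x z < e) ->
  exists E : set X,
    (forall e : R, 0 < e -> exists2 z, E z & 0 < mdist x z < e) /\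
    (forall e : R, 0 < e -> exists2 w, 0 < mdist x w < e &
       forall z, E z -> mdist x w <= 2 * mdist w z).
Proof.
move=> xlim.
have /choice[s sP] : forall z, exists z', 0 < mdist x z ->
    0 < mdist x z' < mdist x z / 4.
  move=> z; have [z0|_] := boolP (0 < mdist x z); last by exists z.
  by have [|z' z'P] := xlim (mdist x z / 4); [rewrite divr_gt0|exists z'].
have [z0 /andP[z0_gt0 _]] := xlim 1 ltr01.
pose u n := iter n s z0; pose r n := mdist x (u n).
have r_gt0 n : 0 < r n by elim: n => //= n /sP /andP[].
have rS n : r n.+1 < r n / 4 by have /sP/andP[] := r_gt0 n.
have r_lt m n : (m < n)%N -> r n < r m / 4.
  elim: n => // n IH; rewrite ltnS leq_eqVlt => /predU1P[->//|/IH].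
  by have := rS n; have := r_gt0 n; lra.
have r_cvg e : 0 < e -> exists N, forall n, (N <= n)%N -> r n < e.
  (* The geometric decay is only used through the weaker [r n <= r 0 / (n + 1)],
     for which the Archimedean property is enough. *)
  move=> e0; have rn n : r n * n.+1%:R <= r 0%N.
    elim: n => [|n IH]; first by rewrite mulr1.
    apply: le_trans IH; rewrite -[n.+2%:R]natr1 -[n.+1%:R]natr1.
    by have := rS n; have := r_gt0 n; have := ler0n R n; nra.
  exists (Num.bound (r 0%N / e)) => n Nn.
  have := archi_boundP (divr_ge0 (ltW (r_gt0 0%N)) (ltW e0)).
  rewrite ltr_pdivrMr// => rN; rewrite -(@ltr_pM2r _ n.+1%:R)//.
  apply: le_lt_trans (rn n) (lt_le_trans rN _).
  by rewrite mulrC ler_wpM2l ?(ltW e0)// ler_nat (leq_trans Nn).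
exists [set u k.*2 | k in setT]; split=> e /r_cvg[N rN].
  exists (u N.*2); first by exists N.
  by rewrite r_gt0 rN// -addnn leq_addr.
exists (u N.*2.+1) => [|_ [k _ <-]].
  by rewrite r_gt0 rN// ltnW// ltnS -addnn leq_addr.
have tri1 := metric_triangle x (u N.*2.+1) (u k.*2).
have tri2 := metric_triangle x (u k.*2) (u N.*2.+1).
rewrite (metric_sym (u k.*2)) in tri2.
rewrite -!/(r _) in tri1 tri2 *.
have := r_gt0 N.*2.+1; have := r_gt0 k.*2.
have [kN|kN|kN] := ltngtP k.*2 N.*2.+1.
- by have := r_lt _ _ kN; lra.
- by have := r_lt _ _ kN; lra.
- by have := congr1 odd kN; rewrite /= !odd_double.
Qed.

(** With [K] above the Lipschitz constants of [f] and [g], it suffices that [h] lie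
below [f x - K d(x, z)] at some points and above [f x + K d(x, z)] at others.
Starting from [f x - 2 K d(x, z)] and adding a multiple of the distance to a
lacunary set [E] does it: on [E] nothing is added, while at the points [w] far
from [E] the constant 8 makes the added term at least [4 K d(x, w)]. *)
Lemma zigzag (x : X) (f g : Lip X) :
    (forall e : R, 0 < e -> exists z, 0 < mdist x z < e) -> f x <= g x ->
  exists h : Lip X,
    (forall e : R, 0 < e -> exists2 z, mdist x z < e &
       \forall z' \near z, f z' <= h z') /\
    (forall e : R, 0 < e -> exists2 z, mdist x z < e &
       \forall z' \near z, h z' <= g z').
Proof.
move=> xlim fgx.
have [K0 K0_ge0 fK] := lip_lipschitz f.
have [L0 L0_ge0 gL] := lip_lipschitz g.
pose K := K0 + L0 + 1.
(* The extra 1 makes [K] positive, which is what separates [2 K] from [K] in the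
   two strict inequalities below. *)
have fle z : f z <= f x + K * mdist x z.
  have := fK x z; rewrite ler_norml => /andP[+ _].
  by have := mdist_ge0 x z; rewrite /K; nra.
have gge z : f x - K * mdist x z <= g z.
  have := gL x z; rewrite ler_norml => /andP[_].
  by have := mdist_ge0 x z; rewrite /K; nra.
have K_gt0 : 0 < K by rewrite /K; lra.
have [E [Ex wx]] := lacunary_set xlim.
have E0 : E !=set0 by have [z Ez _] := Ex 1 ltr01; exists z.
have uL := lipschitz_add (lipschitz_cst _ (f x))
  (lipschitz_add (lipschitz_scale (- (2 * K)) (lipschitz_mdist x))
     (lipschitz_scale (8 * K) (lipschitz_setdist E0))).
exists (clip_lip uL); split=> e e0.
  have [w /andP[xw0 xwe] wE] := wx _ e0; exists w => //.
  have dw : mdist x w <= 2 * setdist E w.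
    by rewrite mulrC -ler_pdivrMr//; apply: le_setdist => // z /wE; lra.
  have : f w < f x + (- (2 * K) * mdist x w + 8 * K * setdist E w).
    by have := fle w; nra.
  move=> /(lipschitz_lt_near (lip_lipschitz f) uL); apply: filterS => z /ltW fu.
  by apply: le_clip01 => //; exact: lip_le1.
have [z Ez /andP[xz0 xze]] := Ex _ e0; exists z => //.
have dz : setdist E z <= 0 by rewrite -(mdistxx z); exact: setdist_le.
have : f x + (- (2 * K) * mdist x z + 8 * K * setdist E z) < g z.
  by have := gge z; nra.
move=> /(lipschitz_lt_near uL (lip_lipschitz g)); apply: filterS => v /ltW ug.
by apply: clip01_le => //; exact: lip_ge0.
Qed.

End Zigzag.

(** * Support points *)

(** Elementwise form of: [x] lies in the closure of [{h > 0}] for every [h] with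
[T h y > 0]. *)
Definition supports (R : realType) (X Y : metricType R) (T : Lip X -> Lip Y)
    (y : Y) (x : X) : Prop :=
  forall h : Lip X, (\forall z \near x, h z = 0) -> T h y = 0.

Lemma lattice_isomorphism_inv (d d' : Order.disp_t) (L : latticeType d)
    (M : latticeType d') (T : L -> M) : lattice_isomorphism T ->
  exists S : M -> L, [/\ lattice_isomorphism S, cancel T S & cancel S T].
Proof.
move=> [[S TK SK] TI TU]; exists S; split=> //; split; first by exists T.
- by move=> f g; apply: (can_inj TK); rewrite TI !SK.
- by move=> f g; apply: (can_inj TK); rewrite TU !SK.
Qed.

Section SupportPoint.
Context (R : realType) (X Y : metricType R).
Variables (T : Lip X -> Lip Y) (S : Lip Y -> Lip X).
Hypotheses (Tiso : lattice_isomorphism T) (TK : cancel T S) (SK : cancel S T).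

Lemma iso_meetE f g y : T (f `&` g)%O y = Num.min (T f y) (T g y).
Proof. by have [_ TI _] := Tiso; rewrite TI Lip_meetE. Qed.

Lemma iso_joinE f g y : T (f `|` g)%O y = Num.max (T f y) (T g y).
Proof. by have [_ _ TU] := Tiso; rewrite TU Lip_joinE. Qed.

Lemma iso_le (f g : Lip X) : (forall x, f x <= g x) -> forall y, T f y <= T g y.
Proof.
move=> fg y; have <- : (f `&` g)%O = f.
  by apply: lip_ext => x; rewrite Lip_meetE min_l.
by rewrite iso_meetE ge_min lexx orbT.
Qed.

(** An isomorphism preserves the least element, here the constant 0. *)
Lemma iso0 (f : Lip X) : (forall x, f x = 0) -> forall y, T f y = 0.
Proof.
move=> f0 y; apply/eqP; rewrite eq_le lip_ge0 andbT.
rewrite -(cst_lip0 y) -[cst_lip Y 0]SK; apply: iso_le => x.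
by rewrite f0 lip_ge0.
Qed.

Lemma iso1 (f : Lip X) : (forall x, f x = 1) -> forall y, T f y = 1.
Proof.
move=> f1 y; apply/eqP; rewrite eq_le lip_le1 /=.
rewrite -(cst_lip1 y) -[cst_lip Y 1]SK; apply: iso_le => x.
by rewrite f1 lip_le1.
Qed.

(** The support point is a cluster point of the filter generated by the sets
[{h > 0}] with [T h y > 0].  This filter is proper because [T h] vanishes when [h]
does, and closed under intersection because [T] preserves minima. *)
Lemma supports_exists (y : Y) : compact [set: X] -> exists x, supports T y x.
Proof.
move=> cX.
pose F : set_system X := fun A =>
  exists2 h : Lip X, 0 < T h y & forall z, 0 < h z -> A z.
have FF : ProperFilter F.
  split.
    move=> [h Thy h0]; suff /(_ y) Th0 : forall y, T h y = 0.
      by rewrite Th0 ltxx in Thy.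
    apply: iso0 => x; apply/eqP; rewrite eq_le lip_ge0 andbT leNgt.
    by apply/negP => /h0.
  split.
  - by exists (cst_lip X 1) => //; rewrite iso1// => x; rewrite cst_lip1.
  - move=> A B [h Thy hA] [k Tky kB]; exists (h `&` k)%O.
      by rewrite iso_meetE lt_min Thy.
    by move=> z; rewrite Lip_meetE lt_min => /andP[/hA Az /kB Bz].
  - by move=> A B AB [h Thy hA]; exists h => // z /hA /AB.
have [|x [_ xF]] := cX F FF.
  by exists (cst_lip X 1) => //; rewrite iso1// => x; rewrite cst_lip1.
exists x => h h0; apply/eqP; rewrite eq_le lip_ge0 andbT leNgt.
apply/negP => Thy; have Fh : F [set z | 0 < h z] by exists h.
have [z [/= hz hz0]] := xF _ _ Fh h0.
by rewrite hz0 ltxx in hz.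
Qed.

(** Some [l] vanishes near [x] and satisfies [max h l = 1]; then
[max (T h y) (T l y) = 1] while [T l y = 0]. *)
Lemma supports_eq1 y x (h : Lip X) :
  supports T y x -> (\forall z \near x, h z = 1) -> T h y = 1.
Proof.
move=> yx h1; pose U := [set z | h z = 1].
have /lip_bump[k [k1 k0]] : nbhs x U by [].
have lL : is_lipschitz (fun z => 1 + (-1) * k z).
  exact: lipschitz_add (lipschitz_cst _ _)
    (lipschitz_scale _ (lip_lipschitz _)).
pose l := clip_lip lL.
have lx : \forall z \near x, l z = 0.
  by apply: filterS k1 => z kz; rewrite /= kz; apply: clip01_le0; lra.
have hl1 z : (h `|` l)%O z = 1.
  rewrite Lip_joinE; have [hz|/k0 kz] := pselect (h z = 1).
    by rewrite hz max_l// lip_le1.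
  by rewrite /= kz mulr0 addr0 clip01_ge1// max_r// lip_le1.
have := iso1 hl1 y; rewrite iso_joinE (yx _ lx).
by rewrite max_l// lip_ge0.
Qed.

(** If [h] is a bump at [x] living where [f <= g], then [min f h <= g] everywhere,
and [T h y = 1] makes [h] disappear from the image of this inequality at [y]. *)
Lemma supports_local y x (f g : Lip X) :
  supports T y x -> (\forall z \near x, f z <= g z) -> T f y <= T g y.
Proof.
move=> yx fg; have /lip_bump[h [h1 h0]] : nbhs x [set z | f z <= g z] by [].
have fhg z : (f `&` h)%O z <= g z.
  rewrite Lip_meetE ge_min; have [->//|/h0 ->] := pselect (f z <= g z).
  by rewrite lip_ge0 orbT.
have := iso_le fhg y; rewrite iso_meetE (supports_eq1 yx h1).
by rewrite min_l// lip_le1.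
Qed.

(** Let [k] vanish near [y], and let [l] be a bump at [y] disjoint from [k].  The
preimages [S k] and [S l] are disjoint too, so if [S k] were positive at [x], then
[S l] would vanish near [x], forcing [l y = 0]
instead of 1. *)
Lemma supports_sym y x : supports T y x -> supports S x y.
Proof.
move=> yx k k0; apply/eqP; rewrite eq_le lip_ge0 andbT leNgt; apply/negP => Skx.
have /lip_bump[l [l1 l0]] : nbhs y [set z | k z = 0] by [].
have Skl0 z : (S k `&` S l)%O z = 0.
  have -> : (S k `&` S l)%O = S (k `&` l)%O.
    by apply: (can_inj TK); have [_ -> _] := Tiso; rewrite !SK.
  suff -> : (k `&` l)%O = T (cst_lip X 0) by rewrite TK cst_lip0.
  apply: lip_ext => v; rewrite (iso0 (@cst_lip0 _ _)) Lip_meetE.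
  have [->|/l0 ->] := pselect (k v = 0); first by rewrite min_l// lip_ge0.
  by rewrite min_r// lip_ge0.
have Slx : \forall z \near x, S l z = 0.
  have := lipschitz_lt_near (lipschitz_cst _ 0) (lip_lipschitz (S k)) Skx.
  apply: filterS => z Skz; have := Skl0 z; rewrite Lip_meetE.
  by case: leP => [_ Sk0|//]; rewrite Sk0 ltxx in Skz.
have := yx _ Slx; rewrite SK (nbhs_singleton l1) => /eqP.
by rewrite oner_eq0.
Qed.

(** A bump at [x] vanishing near [x'] would have an image equal to both 1 and 0 at
[y]. *)
Lemma supports_uniq y x x' : supports T y x -> supports T y x' -> x = x'.
Proof.
move=> yx yx'; apply: contrapT => xx'.
have d0 : 0 < mdist x x' / 2.
  by rewrite divr_gt0// mdist_gt0; apply/eqP.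
have /lip_bump[h [h1 h0]] : nbhs x (ball x (mdist x x' / 2)).
  exact: nbhsx_ballx.
have hx' : \forall z \near x', h z = 0.
  apply: filterS (nbhsx_ballx x' _ d0) => z /= x'z; apply: h0.
  rewrite !ballEmdist /= in x'z * => xz.
  have := metric_triangle x z x'; rewrite (metric_sym z); lra.
have := supports_eq1 yx h1; rewrite (yx' _ hx') => /eqP.
by rewrite eq_sym oner_eq0.
Qed.

(** If [h] is a small bump at [mu y], then [T h] is positive near [y], and a point
where [T h] is positive has its support point in the closure of [{h > 0}]. *)
Lemma supports_continuous (mu : Y -> X) :
  (forall y, supports T y (mu y)) -> continuous mu.
Proof.
move=> muP y; apply/metricType_numDomainType.cvgrPdist_lt => e e0.
have e20 : 0 < e / 2 by rewrite divr_gt0.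
have /lip_bump[h [h1 h0]] := nbhsx_ballx (mu y) _ e20.
have : cst_lip Y 0 y < T h y.
  by rewrite cst_lip0 (supports_eq1 (muP y) h1).
move=> /(lipschitz_lt_near (lip_lipschitz _) (lip_lipschitz _)).
apply: filterS => v; rewrite cst_lip0 => Thv; rewrite ltNge; apply/negP => ev.
suff hv : \forall z \near mu v, h z = 0 by rewrite (muP v _ hv) ltxx in Thv.
apply: filterS (nbhsx_ballx (mu v) _ e20) => z /= vz; apply: h0.
rewrite !ballEmdist /= in vz * => yz.
have := metric_triangle (mu y) z (mu v); rewrite (metric_sym z); lra.
Qed.

(** The continuous map [nu] carries points near [x] to points near [nu x]; there the
local comparisons of [f] and [g] with the oscillating [h] apply, and the
continuity of the images transfers them to [nu x]. *)
Lemma supports_le (nu : X -> Y) x (f g : Lip X) : continuous nu ->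
  (forall z, supports T (nu z) z) -> f x <= g x -> T f (nu x) <= T g (nu x).
Proof.
move=> nuC nuP fgx.
have [xlim|/existsNP[e /not_implyP[e0 xisol]]] :=
    pselect (forall e : R, 0 < e -> exists z, 0 < mdist x z < e); last first.
  apply: supports_local (nuP x) _.
  apply/metricType_numDomainType.nbhs_mdistP; exists e => // z /= xz.
  have [<-//|] := eqVneq x z; rewrite -mdist_gt0 => xz0.
  by case: xisol; exists z; rewrite xz0.
have [h [fh hg]] := zigzag xlim fgx.
have near_nu (k l : Lip X) : T k (nu x) < T l (nu x) ->
    exists2 e : R, 0 < e & forall z, mdist x z < e -> T k (nu z) < T l (nu z).
  move=> /(lipschitz_lt_near (lip_lipschitz _) (lip_lipschitz _)) /nuC.
  by move=> /metricType_numDomainType.nbhs_mdistP[e e0 eP]; exists e.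
apply: (@le_trans _ _ (T h (nu x))); rewrite leNgt; apply/negP.
- move=> /near_nu[e /fh[z xz /(supports_local (nuP z)) Tz] /(_ z xz)].
  by rewrite ltNge Tz.
- move=> /near_nu[e /hg[z xz /(supports_local (nuP z)) Tz] /(_ z xz)].
  by rewrite ltNge Tz.
Qed.

End SupportPoint.

(** * The representation theorem *)

Theorem theorem2p16 (R : realType) (X Y : metricType R)
    (cX : compact [set: X]) (cY : compact [set: Y])
    (phi : Lip X -> Lip Y) (phi_iso : lattice_isomorphism phi) :
  exists (mu : Y -> X) (m : Y -> R -> R),
    [/\ homeomorphism mu,
        forall y : Y, continuous_increasing_bijection01 (m y) &
        forall (f : Lip X) (y : Y), phi f y = m y (f (mu y))].
Proof.
have [psi [psi_iso phiK psiK]] := lattice_isomorphism_inv phi_iso.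
have /choice[mu muP] : forall y, exists x, supports phi y x.
  by move=> y; exact: supports_exists phi_iso psiK _ cX.
have /choice[nu nuP] : forall x, exists y, supports psi x y.
  by move=> x; exact: supports_exists psi_iso phiK _ cY.
have muP' y : supports psi (mu y) y by exact: supports_sym phi_iso phiK psiK _ _ _.
have nuP' x : supports phi (nu x) x by exact: supports_sym psi_iso psiK phiK _ _ _.
have muK : cancel mu nu.
  by move=> y; exact: supports_uniq psi_iso phiK _ _ _ (nuP _) (muP' _).
have nuK : cancel nu mu.
  by move=> x; exact: supports_uniq phi_iso psiK _ _ _ (muP _) (nuP' _).
have muC : continuous mu by exact: supports_continuous phi_iso psiK _ muP.
have nuC : continuous nu by exact: supports_continuous psi_iso phiK _ nuP.
have phi_le y (f g : Lip X) : f (mu y) <= g (mu y) -> phi f y <= phi g y.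
  move=> fg; rewrite -{1 2}(muK y).
  exact: (supports_le phi_iso psiK nuC nuP').
have psi_le y (f g : Lip Y) : f y <= g y -> psi f (mu y) <= psi g (mu y).
  move=> fg.
  exact: (supports_le psi_iso phiK muC muP').
pose m y t := phi (cst_lip X t) y.
pose n y t := psi (cst_lip Y t) (mu y).
have phiE f y : phi f y = m y (f (mu y)).
  by apply/eqP; rewrite eq_le !phi_le// cst_lipE// lip_itv.
have psiE g y : psi g (mu y) = n y (g y).
  by apply/eqP; rewrite eq_le !psi_le// cst_lipE// lip_itv.
have nK y : {in `[0, 1], cancel (n y) (m y)}.
  by move=> s s01; rewrite -phiE psiK cst_lipE.
have mK y : {in `[0, 1], cancel (m y) (n y)}.
  by move=> t t01; rewrite -psiE phiK cst_lipE.
have m_mono y : {in `[0, 1] &, {mono m y : s t / s <= t}}.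
  move=> s t s01 t01; apply/idP/idP => [|st]; last first.
    by apply: phi_le; rewrite !cst_lipE.
  rewrite -{2}(mK y s s01) -{2}(mK y t t01) => mst.
  by apply: psi_le; rewrite !cst_lipE ?lip_itv.
have m0 y : m y 0 = 0 by exact: iso0 phi_iso psiK _ (@cst_lip0 _ _) y.
have m1 y : m y 1 = 1 by exact: iso1 phi_iso psiK _ (@cst_lip1 _ _) y.
exists mu, m; split=> [|y|//]; first by split=> //; exists nu.
have m_bij : set_bij `[0, 1] `[0, 1] (m y).
  split.
  - by move=> t _; exact: lip_itv.
  - by apply: can_in_inj => t /set_mem; exact: mK.
  - by move=> s s01; exists (n y s); [exact: lip_itv|exact: nK].
split=> //; last by move=> s t s01 t01; rewrite (leW_mono_in (m_mono y)).
apply: segment_inc_surj_continuous (m_mono y) _.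
by rewrite m0 m1; case: m_bij.
Qed.
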